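(* Let $F\in K[x_0,x_1,x_2,x_3]_4$ be a homogeneous polynomial admitting a decomposition of the form $F=\sum_{i=1}^8\lambda_iL_i^4$. Set $H_L=\langle L_1^3,\dots,L_8^3\rangle$, $\overline{H}_L=\overline{\pi_{H_{\partial F}^1}(H_L)}\cong\mathbb{P}^3$, let $W\subset\mathbb{P}^{19}$ be the elliptic curve containing the decomposition of $F$, and let $\overline{W}=\pi_{H_{\partial F}^1}(W)$. Then the elliptic normal curve $C\subset\overline{H}_L$ through the points $\pi_{H_{\partial F}^1}(\{L_1^3,\dots,L_8^3\})$ is contained in all the hypersurfaces of degree $c\in\{1,2\}$ in the ideal of $\overline{W}$.
   Context: $K$ is a field; $K[x_0,\dots,x_3]_e$ is the space of homogeneous polynomials of degree $e$, and $\mathbb{P}^{19}=\mathbb{P}(K[x_0,\dots,x_3]_3)$. $H_{\partial F}^1\subset\mathbb{P}^{19}$ is the linear subspace spanned by the first partial derivatives of $F$, and $\pi_{H_{\partial F}^1}$ is the linear projection of $\mathbb{P}^{19}$ with center $H_{\partial F}^1$. Angle brackets denote projective linear span, and the overline on $\overline{\pi(H_L)}$ denotes Zariski closure. A decomposition has $\lambda_i\in K^*$ and $L_i$ linear forms such that the $L_i^4$ are linearly independent. The elliptic curve $W$: the general rank $8$ quartic form in four variables has exactly two decompositions in $8$ powers, and the corresponding points of the dual space $\mathbb{P}^{3*}=\mathbb{P}(K[x_0,\dots,x_3]_1)$ lie on an elliptic curve $E\subset\mathbb{P}^{3*}$ (a complete intersection of two quadrics through $[L_1],\dots,[L_8]$).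 $W$ is the image of $E$ in $\mathbb{P}^{19}$ under the cubic Veronese embedding $[L]\mapsto[L^3]$; in particular $[L_i^3]\in W$ for all $i$. The elliptic normal curve $C\subset\overline{H}_L\cong\mathbb{P}^3$ is the quartic elliptic curve, complete intersection of two quadrics of $\overline{H}_L$, through the eight projected points. As in the source, the statement concerns the situation where these curves $W$ and $C$ exist as described. *)

(* Defs.v *)
From mathcomp Require Import all_boot all_order all_algebra.
From mathcomp Require Import mpoly.

Set Implicit Arguments.
Unset Strict Implicit.
Unset Printing Implicit Defensive.

Import GRing.Theory.
Local Open Scope ring_scope.

(* Forms of degree d in n variables are the elements of [dhomog n R d].  For  *)
(* n > 0 this is a vector space, and its projectivisation is handled through  *)
(* nonzero vectors: linear subspaces of P(V) are elements of {vspace V}, and  *)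
(* other subsets of P(V) are predicates on nonzero vectors of V.              *)

Section Forms.

Variables (n : nat) (R : comNzRingType).

Lemma linpow_homog (l : dhomog n R 1) k :
  (l : {mpoly R[n]}) ^+ k \is k.-homog.
Proof. by rewrite -[X in X.-homog]mul1n; exact/dhomogMn/dhomog_is_dhomog. Qed.

Definition linpow (l : dhomog n R 1) k : dhomog n R k :=
  DHomog (linpow_homog l k).

Lemma dhderiv_homog d (f : dhomog n R d) i :
  (f : {mpoly R[n]})^`M(i) \is (d.-1).-homog.
Proof.
rewrite /mderiv rpred_sum // => m _; case: (posnP (m i)) => [->|mi_gt0].
  by rewrite mul0r scale0r rpred0.
have [/eqP md|md] := boolP (mdeg m == d); last first.
  by rewrite (dhomog_nemf_coeff (dhomog_is_dhomog f)) // mulr0 scale0r rpred0.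
rewrite rpredZ // dhomogX /= -md; apply/eqP.
have le_im : (U_(i) <= m)%MM by rewrite lep1mP -lt0n.
by rewrite -[in RHS](submK le_im) mdegD mdeg1 addn1.
Qed.

Definition dhderiv d (f : dhomog n R d) i : dhomog n R d.-1 :=
  DHomog (dhderiv_homog f i).

End Forms.

Section BaseChange.

Variables (n : nat) (K S : comNzRingType) (iota : {rmorphism K -> S}).

Lemma dhmap_homog d (f : dhomog n K d) :
  map_mpoly iota (f : {mpoly K[n]}) \is d.-homog.
Proof.
apply/dhomogP => m; rewrite mcoeff_msupp mcoeff_map_mpoly => fm.
apply: (dhomog_mf (dhomog_is_dhomog f)); rewrite mcoeff_msupp.
by apply: contraNneq fm => ->; rewrite raddf0.
Qed.

Definition dhmap d (f : dhomog n K d) : dhomog n S d := DHomog (dhmap_homog f).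

End BaseChange.

Definition cubes_span (k : fieldType) (r : nat) (L : 'I_r -> dhomog 4 k 1) :
    {vspace dhomog 4 k 3} :=
  <<codom (fun i => linpow (L i) 3)>>%VS.

Definition partials_span (k : fieldType) (F : dhomog 4 k 4) :
    {vspace dhomog 4 k 3} :=
  <<codom (dhderiv F)>>%VS.

(* A choice of coordinates on the target of the projection of P(V) with       *)
(* center P(Z): a linear map onto k^m with kernel Z.  It is undefined at the  *)
(* points of P(Z), where it takes the value 0.                                *)
Definition projection_from (k : fieldType) (V : vectType k) (Z : {vspace V})
    (m : nat) (pi : 'Hom(V, 'rV[k]_m)) : Prop :=
  lker pi = Z /\ limg pi = fullv.

Definition proj_image (k : fieldType) (V : vectType k) (m : nat)
    (pi : 'Hom(V, 'rV[k]_m)) (X : V -> Prop) (v : 'rV[k]_m) : Prop :=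
  v != 0 /\ exists2 x, X x & v = pi x.

(* The image of a subset of P(k[x]_1) in P(k[x]_3) under [L] |-> [L^3]; over  *)
(* an algebraically closed field k every multiple of a cube is a cube.        *)
Definition cubic_veronese (k : fieldType)
    (E : dhomog 4 k 1 -> Prop) (f : dhomog 4 k 3) : Prop :=
  exists2 l, E l & f = linpow l 3.

Definition on_quadrics (k : fieldType) (q : 'I_2 -> {mpoly k[4]})
    (p : 'rV[k]_4) : Prop :=
  p != 0 /\ forall i, (q i).@[p 0] = 0.

(* Jacobian criterion.  With k algebraically closed it says that q 0 = q 1 = 0 *)
(* is a smooth complete intersection curve in P^3; such a curve is connected  *)
(* and has trivial canonical bundle by adjunction, i.e. it is an elliptic     *)
(* curve (of degree 4).                                                       *)
Definition smooth_quadrics (k : fieldType) (q : 'I_2 -> {mpoly k[4]}) : Prop :=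
  forall p, on_quadrics q p ->
    \rank (\matrix_(i < 2, j < 4) ((q i)^`M(j)).@[p 0]) = 2%N.

(* C is an elliptic curve in P(U), complete intersection of two quadrics of   *)
(* P(U), where phi identifies P^3 with P(U).                                  *)
Definition elliptic_quartic (k : closedFieldType) (V : vectType k)
    (U : {vspace V}) (C : V -> Prop) : Prop :=
  exists (phi : 'Hom('rV[k]_4, V)) (q : 'I_2 -> {mpoly k[4]}),
    [/\ lker phi = 0%VS, limg phi = U,
        forall i, q i \is 2.-homog,
        smooth_quadrics q
      & forall v, C v <-> exists2 p, on_quadrics q p & v = phi p].

Definition vanishes_on (k : fieldType) (m : nat) (G : {mpoly k[m]})
    (X : 'rV[k]_m -> Prop) : Prop :=
  forall v, X v -> G.@[v 0] = 0.

(* Main.v *)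
(* Only the eight points are used: a form of degree 1 (after squaring) or 2   *)
(* vanishing on the projection of W restricts to a quadric g of P(HbarL)      *)
(* through them.  If C is given by the quadrics q0, q1, then                  *)
(* q0 + t g = q1 = 0 contains the eight points for all t, and is again a      *)
(* smooth curve for some t <> 0; by uniqueness of C it coincides with C, so g *)
(* vanishes on C.                                                             *)
(* Smoothness is open in t because P^n is proper: the projection to the       *)
(* t-line of the incidence variety of singular points is closed.  This is     *)
(* proved by eliminating one homogeneous coordinate at a time, lifting points *)
(* along the last coordinate by means of resultants, as in E. Arrondo's proof *)
(* of the Nullstellensatz.                                                    *)

Require Import Defs.
From Stdlib Require Import Classical.
From mathcomp Require Import all_boot all_order all_algebra.
From mathcomp Require Import mpoly.

Set Implicit Arguments.
Unset Strict Implicit.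
Unset Printing Implicit Defensive.

Import GRing.Theory.
Local Open Scope ring_scope.

(** Pulled back along [phi] to P^3, a quadric through the projected points becomes a form g
    vanishing at their preimages. The pair [perturb q g t], that is q0 + t g and q1, vanishes there
    for every t. [smooth_perturb_exists] supplies t <> 0 for which this pair is again smooth; then
    [C_uniq] forces t g = 0 on C. A linear form is replaced by its square. Smoothness comes from
    [projective_zeros_open]: homogeneous equations over Omega[t] with only the trivial zero at t = 0
    keep this property wherever a suitable r with r(0) <> 0 does not vanish. This rests on
    [trivial_fibre_open], an induction on the variables that projects from a point outside the
    closed fibre and lifts points back by resultants ([fibre_lift]). *)

Local Notation widen := (widen_ord (leqnSn _)).

(** * Evaluation through a coefficient morphism *)

Section MPolyEval.

Variables (n : nat) (R S : comNzRingType) (f : {rmorphism R -> S}).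

Lemma eq_mmap (x y : 'I_n -> S) (p : {mpoly R[n]}) :
  x =1 y -> mmap f x p = mmap f y p.
Proof. by move=> xy; apply/eq_bigr => m _; rewrite (mmap1_eq m xy). Qed.

Lemma mmap_homog_scale d (p : {mpoly R[n]}) (c : S) (x : 'I_n -> S) :
  p \is d.-homog -> mmap f (fun i => c * x i) p = c ^+ d * mmap f x p.
Proof.
move=> /dhomogP hp; rewrite /mmap mulr_sumr !big_seq; apply/eq_bigr => m /hp /= <-.
rewrite mulrCA /mmap1; under eq_bigr do rewrite exprMn.
by rewrite big_split /= prodrXr -mdegE.
Qed.

Lemma mmap_map_mpoly (Q : comNzRingType) (g : {rmorphism Q -> R})
    (x : 'I_n -> S) (p : {mpoly Q[n]}) :
  mmap f x (map_mpoly g p) = mmap (f \o g) x p.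
Proof.
elim/mpolyind: p => [|c m p _ _ IHp]; first by rewrite !raddf0.
by rewrite !raddfD /= IHp map_mpolyZ map_mpolyX !mmapZ !mmapX.
Qed.

Lemma mmap_minor (x : 'I_n -> S) (a b c d : {mpoly R[n]}) :
  mmap f x (a * b - c * d) =
  mmap f x a * mmap f x b - mmap f x c * mmap f x d.
Proof. by rewrite rmorphB !rmorphM. Qed.

End MPolyEval.

(** * Polynomials as univariate in the last variable *)

Section MPolyLastVariable.

Variables (n : nat) (R : comNzRingType).
Implicit Type p : {mpoly R[n.+1]}.

Lemma muni_ord_max : muni 'X_ord_max = 'X :> {poly {mpoly R[n]}}.
Proof.
rewrite muniE msuppX big_seq1 mcoeffX eqxx scale1r mnm1E eqxx expr1.
rewrite (_ : [multinom _ | i < n] = 0%MM) ?mpolyX0 ?scale1r //.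
apply/mnmP => i; rewrite !mnmE; case: eqP => // /(congr1 val) /= e.
by have := ltn_ord i; rewrite -e ltnn.
Qed.

Lemma mmap_muni (S : comNzRingType) (f : {rmorphism R -> S})
    (x : 'I_n.+1 -> S) p :
  mmap f x p = (map_poly (mmap f (x \o widen)) (muni p)).[x ord_max].
Proof.
rewrite muniE rmorph_sum horner_sum; apply: eq_bigr => m _.
rewrite /= map_polyZ /= map_polyXn hornerZ hornerXn mmapZ mmapX -mulrA.
congr (_ * _); rewrite /mmap1 big_ord_recr /=; congr (_ * _).
by apply: eq_bigr => i _; rewrite mnmE.
Qed.

Lemma mnm_last_eq d (m : 'X_{1..n.+1}) :
  mdeg m = d -> (forall i : 'I_n, m (widen i) = 0%N) ->
  m = (U_(ord_max) *+ d)%MM.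
Proof.
move=> <- m0; rewrite mdegE big_ord_recr /= big1 ?add0n //.
apply/mnmP => i; rewrite mulmnE mnm1E; case: (unliftP ord_max i) => [j ->|->].
  rewrite (negbTE (neq_lift _ _)) mul0n -[RHS](m0 j); congr (m _).
  by apply/val_inj; rewrite /= /bump leqNgt ltn_ord.
by rewrite eqxx mul1n.
Qed.

(** Any other monomial of degree d contains an earlier variable, hence dies on the last axis. *)
Lemma mmap_homog_last (S : comNzRingType) (f : {rmorphism R -> S}) d p
    (x : 'I_n.+1 -> S) :
  p \is d.-homog -> (forall i : 'I_n, x (widen i) = 0) ->
  mmap f x p = f p@_(U_(ord_max) *+ d) * x ord_max ^+ d.
Proof.
move=> hp x0; set m0 := (_ *+ _)%MM.
have ->: x ord_max ^+ d = mmap1 x m0.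
  rewrite /mmap1 big_ord_recr /= big1 => [|i _]; last first.
    rewrite mulmnE mnm1E; case: eqP => [/(congr1 val) /= e|_ //].
    by have := ltn_ord i; rewrite -e ltnn.
  by rewrite mulmnE mnm1E eqxx mul1n mul1r.
rewrite /mmap; have [m0p|m0p] := boolP (m0 \in msupp p); last first.
  rewrite (memN_msupp_eq0 m0p) raddf0 mul0r big_seq big1 // => m mp.
  suff [i mi] : exists i : 'I_n, m (widen i) != 0%N.
    by rewrite /mmap1 big_ord_recr /= (bigD1 i) //= x0 expr0n (negbTE mi) !(mul0r, mulr0).
  apply/existsP; apply: contraNT m0p; rewrite negb_exists => /forallP mi.
  suff <- : m = m0 by []; apply: mnm_last_eq; first exact: (dhomog_mf hp).
  by move=> i; apply/eqP; rewrite -[_ == _]negbK.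
rewrite (bigD1_seq m0) ?msupp_uniq //= big_seq_cond big1 ?addr0 // => m /andP[mp mm].
suff [i mi] : exists i : 'I_n, m (widen i) != 0%N.
  by rewrite /mmap1 big_ord_recr /= (bigD1 i) //= x0 expr0n (negbTE mi) !(mul0r, mulr0).
apply/existsP; apply: contraNT mm; rewrite negb_exists => /forallP mi.
apply/eqP/mnm_last_eq; first exact: (dhomog_mf hp).
by move=> i; apply/eqP; rewrite -[_ == _]negbK.
Qed.

Lemma size_muni_homog d p : p \is d.-homog -> (size (muni p) <= d.+1)%N.
Proof.
move=> /dhomogP hp; rewrite muniE big_seq.
apply: (leq_trans (size_sum _ _ _)); apply/bigmax_leqP_seq => m _ mp.
apply: (leq_trans (size_scale_leq _ _)); rewrite size_polyXn ltnS -(hp m mp).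
by rewrite /= mdegE (bigD1 ord_max) //= leq_addr.
Qed.

(** The degree is used up by the last variable, so this coefficient is a constant: specialising the
    earlier variables cannot kill it. *)
Lemma coef_muni_homog d p : p \is d.-homog ->
  (muni p)`_d = (p@_(U_(ord_max) *+ d))%:MP.
Proof.
move=> /dhomogP hp; set m0 := (_ *+ _)%MM.
have m0m : m0 ord_max = d by rewrite mulmnE mnm1E eqxx mul1n.
have only m : m \in msupp p -> m != m0 ->
    (p@_m *: 'X_[[multinom m (widen i) | i < n]] *: 'X^(m ord_max))`_d = 0.
  move=> mp mm; rewrite coefZ coefXn; case: eqP => [md|]; rewrite ?mulr0 //.
  case/eqP: mm; apply: mnm_last_eq (hp m mp) _ => i.
  apply/eqP; have := hp m mp; rewrite /= mdegE big_ord_recr /= -md.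
  by move=> /eqP; rewrite -[X in _ == X]add0n eqn_add2r sum_nat_eq0 => /forallP/(_ i).
rewrite muniE coef_sum; have [m0p|m0p] := boolP (m0 \in msupp p); last first.
  rewrite (memN_msupp_eq0 m0p) mpolyC0 big_seq big1 // => m mp; apply: only => //.
  by apply: contraNneq m0p => <-.
rewrite (bigD1_seq m0) ?msupp_uniq //= big_seq_cond big1 => [|m /andP[mp mm]]; last exact: only.
rewrite addr0 coefZ coefXn m0m eqxx mulr1 (_ : [multinom _ | i < n] = 0%MM).
  by rewrite mpolyX0 alg_mpolyC.
apply/mnmP => i; rewrite mnmE mulmnE mnm1E mnm0E; case: eqP => [/(congr1 val) /= e|_ //].
by have := ltn_ord i; rewrite -e ltnn.
Qed.

End MPolyLastVariable.

(** * Resultants under specialisation *)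

Lemma horner_map_lin (R S : comNzRingType) (f : {rmorphism R -> S})
    (u v p q : {poly R}) a :
  (map_poly f p).[a] = 0 -> (map_poly f q).[a] = 0 ->
  (map_poly f (u * p + v * q)).[a] = 0.
Proof. by rewrite rmorphD !rmorphM hornerD !hornerM => -> ->; rewrite !mulr0 addr0. Qed.

Lemma map_muni_lin n (R S : comNzRingType) (f : {rmorphism {mpoly R[n]} -> S})
    (u v p q : {mpoly R[n.+1]}) :
  map_poly f (muni (u * p + v * q)) =
  map_poly f (muni u) * map_poly f (muni p) +
  map_poly f (muni v) * map_poly f (muni q).
Proof. by rewrite muniD 2!muniM rmorphD; congr (_ + _); apply: rmorphM. Qed.

(** Replaces p by a polynomial congruent to it modulo q whose leading coefficient is under
    control. *)
Lemma shift_add_lead (R : nzRingType) (p q : {poly R}) : (1 < size q)%N ->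
  let P := 'X^(size p) * q + p in
  (1 < size P)%N /\ lead_coef P = lead_coef q.
Proof.
move=> q_gt1 P; have q_neq0 : q != 0 by rewrite -size_poly_gt0 ltnW.
have size_Xq : size ('X^(size p) * q)%R = (size p + size q)%N.
  by rewrite size_monicM ?monicXn // size_polyXn.
have lt_pq : (size p < size ('X^(size p) * q)%R)%N.
  by rewrite size_Xq -[X in (X < _)%N]addn0 ltn_add2l ltnW.
rewrite size_polyDl // size_Xq lead_coefDl // lead_coef_monicM ?monicXn //.
by split=> //; apply: leq_trans q_gt1 (leq_addl _ _).
Qed.

(** The shape of the Sylvester matrix depends on the sizes of p and q, which [f] preserves when the
    leading coefficients survive. *)
Lemma map_resultant_lead (R S : nzRingType) (f : {rmorphism R -> S})
    (p q : {poly R}) :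
  f (lead_coef p) != 0 -> f (lead_coef q) != 0 ->
  f (resultant p q) = resultant (map_poly f p) (map_poly f q).
Proof.
move=> fp fq; rewrite /resultant -det_map_mx /Sylvester_mx.
rewrite !size_map_poly_id0 // map_col_mx; congr (\det (col_mx _ _)).
- by apply: map_lin1_mx => v; rewrite map_poly_rV rmorphM /= map_rVpoly.
- by apply: map_lin1_mx => v; rewrite map_poly_rV rmorphM /= map_rVpoly.
Qed.

(** After specialisation the first argument is X^k q + 1, which is coprime to q. *)
Lemma resultant_shift_neq0 (R : nzRingType) (F : fieldType)
    (f : {rmorphism R -> F}) (p q : {poly R}) :
  map_poly f p = 1 -> f (lead_coef q) != 0 -> (1 < size q)%N ->
  f (resultant ('X^(size p) * q + p) q) != 0.
Proof.
move=> fp fq q_gt1; have [_ lead_P] := shift_add_lead p q_gt1.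
rewrite map_resultant_lead ?lead_P // rmorphD rmorphM /= fp.
rewrite resultant_eq0 -leqNgt leq_eqVlt; apply/orP; left.
by rewrite -/(coprimep _ _) coprimep_sym coprimep_addl_mul coprimep1.
Qed.

Lemma not_forall_imply (U : Type) (P Q : U -> Prop) :
  ~ (forall u, P u -> Q u) -> exists2 u, P u & ~ Q u.
Proof.
move=> PQ; apply: NNPP => no; apply: PQ => u Pu.
by apply: NNPP => Qu; apply: no; exists u.
Qed.

(** * Elimination theory: properness of projective space *)

Section Elimination.

Variables (Omega : closedFieldType).

(** Otherwise p + 1 would be a nonconstant polynomial without roots. *)
Lemma poly_vanish_eq0 (p : {poly Omega}) : (forall a, p.[a] = 0) -> p = 0.
Proof.
move=> p0; have : size (p + 1) == 1%N.
  apply/negPn/negP => /closed_rootP[a]; rewrite /root hornerD p0 hornerC add0r.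
  by rewrite oner_eq0.
case/size_poly1P => c _ /(canRL (addrK _)) e; move: (p0 0).
by rewrite e -polyCB hornerC => ->; rewrite polyC0.
Qed.

(** Euclidean descent reaches a generator of the ideal J; it is not a unit, so it has a root. *)
Lemma ideal_common_root (J : {poly Omega} -> Prop) :
  J 0 -> (forall u v p q, J p -> J q -> J (u * p + v * q)) -> ~ J 1 ->
  exists a, forall p, J p -> p.[a] = 0.
Proof.
move=> J0 JD J1; have [J_eq0|/not_forall_imply[p0 Jp0 /eqP p0_neq0]] :=
  classic (forall p, J p -> p = 0).
  by exists 0 => p /J_eq0 ->; rewrite horner0.
have [s] := ubnP (size p0).
elim: s p0 Jp0 p0_neq0 => // s IHs p0 Jp0 p0_neq0 /ltnSE le_p0_s.
have [p0dvd|/not_forall_imply[p Jp /negP p0Np]] :=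
  classic (forall p, J p -> p0 %| p).
  have /closed_rootP[a a_root] : size p0 != 1%N.
    apply/negP => /size_poly1P[c c_neq0 p0E]; apply: J1.
    have := JD c^-1%:P 0 _ _ Jp0 Jp0.
    by rewrite mul0r addr0 p0E -polyCM mulVf.
  exists a => p /p0dvd /(dvdp_trans _) p0p; apply/eqP.
  by rewrite -[_ == 0]/(root p a) -dvdp_XsubCl p0p ?dvdp_XsubCl.
apply: (IHs (p %% p0)) => //.
- have := JD 1 (- (p %/ p0)) _ _ Jp Jp0.
  by rewrite {1}(divp_eq p p0) mul1r mulNr addrAC subrr add0r.
- exact: (leq_trans (ltn_modpN0 _ p0_neq0) le_p0_s).
Qed.

Variables (R : comNzRingType) (T : Type) (tau : T -> {rmorphism R -> Omega}).

(* A subset B of T x Omega^n is a family of subsets of Omega^n; its closure   *)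
(* over [t0] is the set of points over [t0] where all the elements of         *)
(* [vanishing B] are zero, and [trivial_fibre B] says that it is at most {0}. *)
Definition vanishing n (B : T -> ('I_n -> Omega) -> Prop) (p : {mpoly R[n]}) :=
  forall t x, B t x -> mmap (tau t) x p = 0.

Definition cone n (B : T -> ('I_n -> Omega) -> Prop) :=
  forall t x c, B t x -> B t (fun i => c * x i).

Lemma vanishing_lin n (B : T -> ('I_n -> Omega) -> Prop) u v p q :
  vanishing B p -> vanishing B q -> vanishing B (u * p + v * q).
Proof.
by move=> Bp Bq t x Btx; rewrite rmorphD /= !rmorphM /= Bp // Bq // !mulr0 addr0.
Qed.

(** On the line through x, p(a x) is a polynomial in a with coefficients p_e(x); it is zero for all
    a. *)
Lemma vanishing_pihomog n (B : T -> ('I_n -> Omega) -> Prop) p d :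
  cone B -> vanishing B p -> vanishing B (pihomog mdeg d p).
Proof.
move=> coneB Bp t x Btx; have [k ub_k] := ubnP (maxn (msize p) d).
pose h := \poly_(e < k) mmap (tau t) x (pihomog mdeg e p).
suff h0 : h = 0.
  have := coef_poly k (fun e => mmap (tau t) x (pihomog mdeg e p)) d.
  by rewrite -/h h0 coef0 (leq_ltn_trans (leq_maxr _ _) ub_k).
apply: poly_vanish_eq0 => a; rewrite horner_poly.
rewrite -[RHS](Bp _ _ (coneB t x a Btx)) [in RHS](@pihomog_partitionE _ _ mdeg k p).
  rewrite raddf_sum; apply: eq_bigr => e _ /=.
  by rewrite (mmap_homog_scale _ _ _ (pihomogP mdeg e p)) mulrC.
exact: ltnW (leq_ltn_trans (leq_maxl _ _) ub_k).
Qed.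

Variable t0 : T.
Hypothesis tau0_surj : forall c, exists r, tau t0 r = c.

Definition trivial_fibre n (B : T -> ('I_n -> Omega) -> Prop) :=
  forall a, (forall p, vanishing B p -> mmap (tau t0) a p = 0) ->
  forall i, a i = 0.

(** Projection from the point (0 : ... : 0 : 1), on the level of cones. *)
Definition shadow n (B : T -> ('I_n.+1 -> Omega) -> Prop) t (y : 'I_n -> Omega) :=
  exists2 x, B t x & y = x \o widen.

(** Ensures that restricting vanishing polynomials to the line over [a] yields an ideal of
    Omega[X]. *)
Lemma muni_map_surj n (a : 'I_n -> Omega) (u : {poly Omega}) :
  exists p : {mpoly R[n.+1]}, map_poly (mmap (tau t0) a) (muni p) = u.
Proof.
elim/poly_ind: u => [|u c [p <-]]; first by exists 0; rewrite !raddf0.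
have [r <-] := tau0_surj c; exists (p * 'X_ord_max + r%:MP).
by rewrite muniD muniM muni_ord_max muniC rmorphD rmorphM /= map_polyX map_polyC /= mmapC.
Qed.

(** The resultant is a combination of p and q free of the last variable. *)
Lemma shadow_resultant n (B : T -> ('I_n.+1 -> Omega) -> Prop) p q :
  vanishing B p -> vanishing B q ->
  (1 < size (muni p))%N -> (1 < size (muni q))%N ->
  vanishing (shadow B) (resultant (muni p) (muni q)).
Proof.
move=> Bp Bq p_gt1 q_gt1 t y [x Btx ->].
have [[u v] _ /= res_uv] := resultant_in_ideal p_gt1 q_gt1.
rewrite -[LHS](hornerC _ (x ord_max)) -map_polyC /= res_uv.
by apply: horner_map_lin; rewrite -mmap_muni; [apply: Bp | apply: Bq].
Qed.

(* [g] has a leading coefficient in the last variable that does not vanish at *)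
(* [t0].  If a vanishing [p] restricts to 1 on the line over [a], then the    *)
(* resultant of [g] and [p + X^k g] vanishes on the shadow but not at [a];    *)
(* adding [X^k g] makes resultants commute with evaluation at [a].            *)
Lemma fibre_lift n (B : T -> ('I_n.+1 -> Omega) -> Prop) d g (a : 'I_n -> Omega) :
  (0 < d)%N -> vanishing B g -> g \is d.-homog ->
  tau t0 g@_(U_(ord_max) *+ d) != 0 ->
  (forall p, vanishing (shadow B) p -> mmap (tau t0) a p = 0) ->
  exists2 b, (forall p, vanishing B p -> mmap (tau t0) b p = 0) &
    b \o widen =1 a.
Proof.
move=> d_gt0 Bg g_homog c_neq0 a_shadow.
set c := g@_ _ in c_neq0; pose phi := mmap (tau t0) a.
have g_d : (muni g)`_d = c%:MP by exact: coef_muni_homog.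
have c_neq0' : c%:MP_[n] != 0.
  by rewrite mpolyC_eq0; apply: contraNneq c_neq0 => ->; rewrite rmorph0.
have size_g : size (muni g) = d.+1.
  apply/eqP; rewrite eqn_leq size_muni_homog //= ltnNge; apply: contra c_neq0'.
  by move=> le_g; rewrite -g_d nth_default.
have lead_g : lead_coef (muni g) = c%:MP by rewrite lead_coefE size_g.
have g_gt1 : (1 < size (muni g))%N by rewrite size_g.
(* The ideal of restrictions to the line over [a]; a common root is the last coordinate of the
   lift. *)
pose J u := exists2 p, vanishing B p & map_poly phi (muni p) = u.
have [||[p Bp p1]|y J_y] := @ideal_common_root J.
- by exists 0; [move=> t x _; rewrite raddf0 | rewrite !raddf0].
- move=> u v _ _ [p Bp <-] [q Bq <-].
  have [[u' <-] [v' <-]] := (muni_map_surj a u, muni_map_surj a v).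
  exists (u' * p + v' * q); last exact: map_muni_lin.
  exact: vanishing_lin.
- pose k := size (muni p).
  pose P := p + 'X_ord_max ^+ k * g.
  have muniP : muni P = 'X^k * muni g + muni p.
    by rewrite muniD muniM rmorphXn /= muni_ord_max addrC.
  have [size_P lead_P] := shift_add_lead (muni p) g_gt1.
  rewrite -muniP in size_P lead_P.
  have BP : vanishing B P.
    by rewrite /P -[p]mul1r; apply: vanishing_lin.
  have phi_g : phi (lead_coef (muni g)) != 0 by rewrite lead_g /phi mmapC.
  have := resultant_shift_neq0 p1 phi_g g_gt1; rewrite -muniP => /eqP; apply.
  exact: a_shadow (shadow_resultant BP Bg size_P g_gt1).
pose b i := if unlift ord_max i is Some j then a j else y.
have ba : b \o widen =1 a.
  move=> i; rewrite /b /= (_ : widen i = lift ord_max i) ?liftK //.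
  by apply/val_inj; rewrite /= /bump leqNgt ltn_ord.
exists b => // p Bp; rewrite mmap_muni (_ : b ord_max = y); last by rewrite /b unlift_none.
rewrite (eq_map_poly (fun q => eq_mmap _ q ba)); apply: J_y; by exists p.
Qed.

(** The centre of projection is not in the closure over [t0], which yields g with leading
    coefficient c. By [fibre_lift] the shadow inherits the trivial fibre, so induction applies to
    it. *)
Lemma trivial_fibre_open n (B : T -> ('I_n -> Omega) -> Prop) :
  cone B -> trivial_fibre B ->
  exists2 r, tau t0 r != 0 &
    forall t x, B t x -> tau t r != 0 -> forall i, x i = 0.
Proof.
elim: n B => [|n IHn] B coneB fibreB.
  by exists 1; [rewrite rmorph1 oner_neq0 | move=> t x _ _ []].
have [d [g [Bg g_homog c_neq0]]] : exists d g,
    [/\ vanishing B g, g \is d.-homog & tau t0 g@_(U_(ord_max) *+ d) != 0].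
  pose e (i : 'I_n.+1) : Omega := (i == ord_max)%:R.
  have [p Bp pe] : exists2 p, vanishing B p & mmap (tau t0) e p <> 0.
    apply: not_forall_imply => e0; suff /eqP : e ord_max = 0 by rewrite /e eqxx oner_eq0.
    exact: fibreB e0 _.
  apply: NNPP => no; apply: pe.
  rewrite (@pihomog_partitionE _ _ mdeg (msize p) p) // raddf_sum big1 // => d _ /=.
  rewrite (mmap_homog_last _ (pihomogP _ d p)) => [|i]; last first.
    rewrite /e; case: eqP => // /(congr1 val) /= ei.
    by have := ltn_ord i; rewrite ei ltnn.
  apply: NNPP => /eqP; rewrite mulf_eq0 => /norP[c_neq0 _]; apply: no.
  exists d, (pihomog mdeg d p); split=> //; last exact: pihomogP.
  exact: vanishing_pihomog.
set c := g@_ _ in c_neq0.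
have widen_case (x : 'I_n.+1 -> Omega) :
    (forall i : 'I_n, x (widen i) = 0) -> x ord_max = 0 -> forall i, x i = 0.
  move=> x0 xn i; case: (unliftP ord_max i) => [j ->|-> //].
  rewrite -[RHS](x0 j); congr x.
  by apply/val_inj; rewrite /= /bump leqNgt ltn_ord.
have on_axis t x : B t x -> (forall i : 'I_n, x (widen i) = 0) -> tau t c != 0 ->
    forall i, x i = 0.
  move=> Btx x0 tc; apply: widen_case => //; have := Bg t x Btx.
  rewrite (mmap_homog_last _ g_homog x0) => /eqP.
  by rewrite mulf_eq0 (negbTE tc) expf_eq0 => /andP[_ /eqP].
(* In degree 0, g is the constant c, so B is empty wherever [tau t c] is nonzero. *)
have [d0|d_gt0] := posnP d.
  exists c => // t x Btx tc; have := Bg t x Btx.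
  have -> : g = c%:MP.
    apply/mpolyP => m; rewrite mcoeffC; case: eqP => [->|/eqP m_neq0].
      by rewrite /c d0 mulm0n mulr1.
    rewrite mulr0; apply: (dhomog_nemf_coeff g_homog).
    by rewrite d0 mdeg_eq0.
  by move/eqP; rewrite mmapC (negbTE tc).
have [|/not_forall_imply[a a_shadow []]] := classic (trivial_fibre (shadow B)).
  case/IHn=> [t _ k [x Btx ->]|r r_neq0 shadow0].
    by exists (fun i => k * x i); first exact: coneB.
  (* Where r survives, all coordinates but the last vanish; where c survives, g then kills the last
     one. *)
  exists (r * c) => [|t x Btx]; first by rewrite rmorphM mulf_neq0.
  rewrite rmorphM mulf_eq0 => /norP[tr tc]; apply: (on_axis t) => // i.
  by apply: (shadow0 t (x \o widen)) => //; exists x.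
move=> i; have [b /fibreB b0 ba] := fibre_lift d_gt0 Bg g_homog c_neq0 a_shadow.
by rewrite -ba /= b0.
Qed.

(** Each [f i] vanishes on the zero family B, so the closure of B over [t0] lies in the zero set at
    [t0]. *)
Lemma projective_zeros_open n (I : Type) (f : I -> {mpoly R[n]}) (d : I -> nat) :
  (forall i, f i \is (d i).-homog) ->
  (forall x, (forall i, mmap (tau t0) x (f i) = 0) -> forall j, x j = 0) ->
  exists2 r, tau t0 r != 0 &
    forall t x, tau t r != 0 ->
      (forall i, mmap (tau t) x (f i) = 0) -> forall j, x j = 0.
Proof.
move=> f_homog f0; pose B t x := forall i, mmap (tau t) x (f i) = 0.
have [|a a0|r r_neq0 Br] := @trivial_fibre_open n B.
- by move=> t x c Btx i; rewrite (mmap_homog_scale _ _ _ (f_homog i)) Btx mulr0.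
- by apply: f0 => i; apply: a0 => t x; apply.
- by exists r => // t x tr Btx; apply: (Br t).
Qed.

End Elimination.

(** * Linear substitutions and 2 x 2 minors *)

Lemma comp_mpoly_homog n k (R : comNzRingType) d (p : {mpoly R[n]})
    (lq : n.-tuple {mpoly R[k]}) :
  p \is d.-homog -> (forall i, tnth lq i \is 1.-homog) -> p \mPo lq \is d.-homog.
Proof.
move=> /dhomogP hp hlq; rewrite comp_mpolyE big_seq rpred_sum // => m /hp /= <-.
apply: rpredZ; rewrite mdegE.
apply: (big_ind2 (fun (P : {mpoly R[k]}) e => P \is e.-homog)).
- exact: dhomog1.
- by move=> P e P' e' hP hP'; apply: dhomogM.
- by move=> i _; rewrite -[X in X.-homog]mul1n; apply: dhomogMn.
Qed.

(** Turns the Jacobian criterion into polynomial equations. *)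
Lemma rank2_minorP (F : fieldType) n (M : 'M[F]_(2, n)) :
  reflect (exists j k, M 0 j * M 1 k - M 0 k * M 1 j != 0) (\rank M == 2%N).
Proof.
apply: (iffP idP) => [M_free|[j [k Mjk]]].
  apply: NNPP => no; have minor0 j k : M 0 j * M 1 k - M 0 k * M 1 j = 0.
    by apply/eqP/negPn/negP => Mjk; apply: no; exists j, k.
  have ker u : u *m M = 0 -> u = 0.
    by move=> uM; apply: (row_free_inj M_free); rewrite uM mul0mx.
  have M1 j : M 1 j = 0.
    (* The vanishing minors put (M 1 j, - M 0 j) in the left kernel. *)
    pose u : 'rV[F]_2 := \row_i (if i == 0 then M 1 j else - M 0 j).
    have /ker /rowP/(_ 0) : u *m M = 0.
      apply/rowP => k; rewrite !mxE big_ord_recl big_ord1 !mxE /=.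
      rewrite (_ : lift _ _ = 1); last exact/val_inj.
      by rewrite mulNr mulrC -[RHS](minor0 k j) addrC [- _ + _]addrC mulrC.
    by rewrite !mxE.
  have /ker /rowP/(_ 1) : delta_mx 0 1 *m M = 0 :> 'rV_n.
    by rewrite -rowE; apply/rowP => k; rewrite !mxE M1.
  by rewrite !mxE !eqxx => /eqP; rewrite oner_eq0.
apply/inj_row_free => u uM.
have eqn l : u 0 0 * M 0 l + u 0 1 * M 1 l = 0.
  move/rowP/(_ l): uM; rewrite !mxE big_ord_recl big_ord1.
  by rewrite (_ : lift _ _ = 1) //; exact/val_inj.
have u0 : u 0 0 * (M 0 j * M 1 k - M 0 k * M 1 j) = 0.
  transitivity ((u 0 0 * M 0 j + u 0 1 * M 1 j) * M 1 k
                - (u 0 0 * M 0 k + u 0 1 * M 1 k) * M 1 j).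
    rewrite mulrBr !mulrDl opprD addrACA -!mulrA [M 1 k * M 1 j]mulrC.
    by rewrite subrr addr0.
  by rewrite !eqn !mul0r subrr.
have u1 : u 0 1 * (M 0 j * M 1 k - M 0 k * M 1 j) = 0.
  transitivity ((u 0 0 * M 0 k + u 0 1 * M 1 k) * M 0 j
                - (u 0 0 * M 0 j + u 0 1 * M 1 j) * M 0 k).
    rewrite mulrBr !mulrDl opprD addrACA -!mulrA [M 0 k * M 0 j]mulrC.
    by rewrite subrr add0r [M 0 j * _]mulrC [M 0 k * _]mulrC.
  by rewrite !eqn !mul0r subrr.
apply/rowP => i; rewrite mxE; move/eqP: u0; move/eqP: u1.
rewrite !mulf_eq0 (negbTE Mjk) !orbF => /eqP u1 /eqP u0.
case: i => [[|[|//]] lt_i]; [rewrite -[RHS]u0|rewrite -[RHS]u1];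
  by congr (u 0 _); apply/val_inj.
Qed.

(** * Smooth members of the pencil q0 + t g, q1 *)

Section Pencil.

Variable Omega : closedFieldType.

(** The factor 'X in r * 'X excludes t = 0. *)
Lemma neq0_nonroot (r : {poly Omega}) : r != 0 -> exists2 t, t != 0 & r.[t] != 0.
Proof.
move=> r_neq0; apply: NNPP => no; case/eqP: (r_neq0); apply/eqP.
have /eqP : r * 'X = 0; last by rewrite mulf_eq0 polyX_eq0 orbF.
apply: poly_vanish_eq0 => a; rewrite hornerM hornerX.
have [->|a_neq0] := eqVneq a 0; first by rewrite mulr0.
apply/eqP; rewrite mulf_eq0 (negbTE a_neq0) orbF; apply/negPn/negP => ra.
by apply: no; exists a.
Qed.

Definition lift_mpoly n (p : {mpoly Omega[n]}) : {mpoly {poly Omega}[n]} :=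
  map_mpoly polyC p.

Lemma lift_mpoly_homog n d (p : {mpoly Omega[n]}) :
  p \is d.-homog -> lift_mpoly p \is d.-homog.
Proof. by move=> hp; apply: (dhmap_homog polyC (DHomog hp)). Qed.

Lemma mmap_lift n t (x : 'I_n -> Omega) (p : {mpoly Omega[n]}) :
  mmap (horner_eval t) x (lift_mpoly p) = p.@[x].
Proof.
rewrite mmap_map_mpoly /meval /mmap; apply: eq_bigr => m _ /=.
by rewrite /horner_eval hornerC.
Qed.

Variables (q : 'I_2 -> {mpoly Omega[4]}) (g : {mpoly Omega[4]}).
Hypotheses (q_homog : forall i, q i \is 2.-homog) (g_homog : g \is 2.-homog).

(** The boolean multiplicity makes only the first quadric move. *)
Definition perturb t (i : 'I_2) : {mpoly Omega[4]} := q i + (t *+ (i == 0)) *: g.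

Lemma perturb_homog t i : perturb t i \is 2.-homog.
Proof. exact: (rpredD (q_homog i) (rpredZ _ g_homog)). Qed.

(* [D (perturb t i)] with [t] as an indeterminate, for [D] linear *)
Definition perturb_gen (i : 'I_2) (D : {mpoly Omega[4]} -> {mpoly Omega[4]}) :=
  lift_mpoly (D (q i)) + ('X *+ (i == 0)) *: lift_mpoly (D g).

Lemma mmap_perturb_gen t x i D :
  mmap (horner_eval t) x (perturb_gen i D) =
  (D (q i)).@[x] + (t *+ (i == 0)) * (D g).@[x].
Proof.
rewrite mmapD mmapZ !mmap_lift /horner_eval; congr (_ + _ * _).
by rewrite /= /horner_eval hornerMn hornerX.
Qed.

Lemma perturb_gen_homog i d (D : {mpoly Omega[4]} -> {mpoly Omega[4]}) :
  (forall p, p \is 2.-homog -> D p \is d.-homog) -> perturb_gen i D \is d.-homog.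
Proof.
move=> hD; apply: rpredD; last apply: rpredZ.
  exact: lift_mpoly_homog (hD _ (q_homog i)).
exact: lift_mpoly_homog (hD _ g_homog).
Qed.

(** Equations of the singular points over Omega[t]: the two quadrics and the Jacobian minors. *)
Definition singular_eqns (e : 'I_2 + 'I_4 * 'I_4) : {mpoly {poly Omega}[4]} :=
  match e with
  | inl i => perturb_gen i id
  | inr (j, k) =>
      perturb_gen 0 (mderiv j) * perturb_gen 1 (mderiv k)
      - perturb_gen 0 (mderiv k) * perturb_gen 1 (mderiv j)
  end.

Lemma singular_eqns_homog e : singular_eqns e \is 2.-homog.
Proof.
have hD i j : perturb_gen i (mderiv j) \is 1.-homog.
  by apply: perturb_gen_homog => p hp; apply: (dhderiv_homog (DHomog hp)).
case: e => [i|[j k]] /=; first exact: perturb_gen_homog.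
by apply: rpredB; apply: (@dhomogM _ _ mdeg 1%N _ 1%N).
Qed.

Lemma smooth_perturbP t :
  smooth_quadrics (perturb t) <->
  (forall x, (forall e, mmap (horner_eval t) x (singular_eqns e) = 0) ->
     forall j, x j = 0).
Proof.
have Q x i : mmap (horner_eval t) x (singular_eqns (inl i)) = (perturb t i).@[x].
  by rewrite /= mmap_perturb_gen mevalD mevalZ.
pose J (x : 'I_4 -> Omega) := \matrix_(i < 2, j < 4) ((perturb t i)^`M(j)).@[x].
have Jgen x i j : mmap (horner_eval t) x (perturb_gen i (mderiv j)) = J x i j.
  by rewrite mmap_perturb_gen mxE mderivD mderivZ mevalD mevalZ.
have M x j k : mmap (horner_eval t) x (singular_eqns (inr (j, k))) =
    J x 0 j * J x 1 k - J x 0 k * J x 1 j.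
  by rewrite [LHS]mmap_minor; congr (_ * _ - _ * _); exact: Jgen.
split=> [smooth x sing|nosing p [p_neq0 pq]].
  pose p : 'rV_4 := \row_i x i.
  have px : p 0 =1 x by move=> i; rewrite mxE.
  apply: NNPP => x_neq0; have p_on : on_quadrics (perturb t) p.
    split=> [|i]; last by rewrite (meval_eq _ px) -Q.
    by apply/eqP => p0; apply: x_neq0 => i; rewrite -px p0 mxE.
  have /eqP/rank2_minorP[j [k]] := smooth p p_on.
  move/eqP; apply; rewrite -[RHS](sing (inr (j, k))) M !mxE.
  by rewrite !(meval_eq _ px).
apply/eqP/rank2_minorP; apply: NNPP => no; case/eqP: p_neq0.
apply/rowP => i; rewrite mxE; apply: nosing => -[j|[j k]]; first by rewrite Q.
by rewrite M; apply/eqP/negPn/negP => Jp; apply: no; exists j, k.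
Qed.

Lemma smooth_perturb_exists :
  smooth_quadrics q -> exists2 t, t != 0 & smooth_quadrics (perturb t).
Proof.
move=> smooth_q.
(* The base ring is Omega[t], specialised by evaluation, with base point t = 0. *)
have [||r r_neq0 nosing] := @projective_zeros_open Omega _ _ (@horner_eval Omega)
  0 _ 4 _ singular_eqns (fun=> 2%N) singular_eqns_homog _.
- by move=> c; exists c%:P; rewrite /= /horner_eval hornerC.
- apply/smooth_perturbP => p [p_neq0 p_on].
  have E i : perturb 0 i = q i by rewrite /perturb mul0rn scale0r addr0.
  rewrite -[RHS](smooth_q p); first by congr (\rank _); apply/matrixP => i j; rewrite !mxE E.
  by split=> // i; rewrite -E.
have r_neq0' : r != 0 by apply: contraNneq r_neq0 => ->; rewrite /= /horner_eval horner0.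
have [t t_neq0 rt] := neq0_nonroot r_neq0'.
by exists t => //; apply/smooth_perturbP => x; apply: nosing.
Qed.

End Pencil.

(** * Restriction to P(HbarL) and conclusion *)

Lemma linear_subst (F : fieldType) n m (phi : 'Hom('rV[F]_n, 'rV[F]_m))
    (G : {mpoly F[m]}) d : G \is d.-homog ->
  exists2 g : {mpoly F[n]}, g \is d.-homog & forall p : 'rV_n, g.@[p 0] = G.@[phi p 0].
Proof.
move=> G_homog.
pose l := [tuple \sum_(i < n) phi (delta_mx 0 i) 0 j *: 'X_i | j < m] : m.-tuple {mpoly F[n]}.
exists (G \mPo l) => [|p].
  apply: comp_mpoly_homog => // j; rewrite tnth_mktuple rpred_sum // => i _.
  by apply: rpredZ; rewrite dhomogX /= mdeg1.
rewrite comp_mpoly_meval; apply: meval_eq => j.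
rewrite tnth_mktuple raddf_sum /= {2}[p]row_sum_delta linear_sum summxE.
by apply: eq_bigr => i _; rewrite mevalZ mevalXU linearZ mxE mulrC.
Qed.

Theorem proposition5p4
  (K : fieldType) (Omega : closedFieldType) (iota : {rmorphism K -> Omega})
  (* the form and its decomposition, over K *)
  (F : dhomog 4 K 4) (lam : 'I_8 -> K) (L : 'I_8 -> dhomog 4 K 1)
  (lam_neq0 : forall i, lam i != 0)
  (L4_free : free (codom (fun i => linpow (L i) 4)))
  (F_dec : F = \sum_(i < 8) lam i *: linpow (L i) 4)
  (* the projection with center H_{dF}, and Hbar_L = P^3 *)
  (m : nat) (pi : 'Hom(dhomog 4 Omega 3, 'rV[Omega]_m))
  (pi_proj : projection_from (partials_span (dhmap iota F)) pi)
  (HbarL : {vspace 'rV[Omega]_m})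
  (HbarL_def : HbarL = (pi @: cubes_span (fun i => dhmap iota (L i)))%VS)
  (HbarL_dim : \dim HbarL = 4%N)
  (* the elliptic curve E through the [L_i], and W *)
  (E : dhomog 4 Omega 1 -> Prop)
  (E_ell : elliptic_quartic fullv E)
  (E_thru : forall i, E (dhmap iota (L i)))
  (W : dhomog 4 Omega 3 -> Prop)
  (W_def : forall f, W f <-> cubic_veronese E f)
  (* the elliptic normal curve C in Hbar_L through the projected points *)
  (C : 'rV[Omega]_m -> Prop)
  (C_ell : elliptic_quartic HbarL C)
  (C_thru : forall i, C (pi (linpow (dhmap iota (L i)) 3)))
  (C_uniq : forall C' : 'rV[Omega]_m -> Prop,
     elliptic_quartic HbarL C' ->
     (forall i, C' (pi (linpow (dhmap iota (L i)) 3))) ->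
     forall v, C' v <-> C v) :
  forall (c : nat) (G : {mpoly Omega[m]}),
    (c == 1%N) || (c == 2%N) ->
    G \is c.-homog ->
    vanishes_on G (proj_image pi W) ->
    vanishes_on G C.
Proof.
have [phi [q [/eqP/lker0P phi_inj phi_img q_homog smooth_q C_def]]] := C_ell.
have p_neq0 i : pi (linpow (dhmap iota (L i)) 3) != 0.
  have /C_def[p [p_neq0 _] ->] := C_thru i.
  by rewrite -(linear0 phi) (inj_eq phi_inj).
suff quadric G : G \is 2.-homog ->
    (forall i, G.@[pi (linpow (dhmap iota (L i)) 3) 0] = 0) -> vanishes_on G C.
  move=> c G c12 G_homog G_W.
  have G_p i : G.@[pi (linpow (dhmap iota (L i)) 3) 0] = 0.
    apply: G_W; split=> //; exists (linpow (dhmap iota (L i)) 3) => //.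
    by apply/W_def; exists (dhmap iota (L i)).
  case/orP: c12 G_homog => /eqP -> G_homog; last exact: quadric.
  (* Degree 1: apply the quadric case to G^2. *)
  move=> v Cv; apply/eqP; rewrite -sqrf_eq0 -rmorphXn; apply/eqP.
  apply: quadric Cv => [|i]; first exact: (dhomogMn 2 G_homog).
  by rewrite rmorphXn /= G_p expr0n.
move=> G_homog G_p v Cv.
have [g g_homog gG] := linear_subst phi G_homog.
have [t t_neq0 smooth_t] := smooth_perturb_exists q_homog g_homog smooth_q.
pose C' v := exists2 p, on_quadrics (perturb q g t) p & v = phi p.
have C'_ell : elliptic_quartic HbarL C'.
  exists phi, (perturb q g t); split=> //; last exact: perturb_homog.
  exact/eqP/lker0P.
have C'_thru i : C' (pi (linpow (dhmap iota (L i)) 3)).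
  have /C_def[p [p0 p_on] e] := C_thru i; exists p => //; split=> // j.
  by rewrite mevalD mevalZ p_on gG -e G_p mulr0 addr0.
(* By injectivity of [phi], one p satisfies both q0(p) = 0 and q0(p) + t g(p) = 0. *)
have /(C_uniq C' C'_ell C'_thru)[p' [_ p'_on] vp'] := Cv.
have /C_def[p [_ p_on] vp] := Cv.
have {}vp' : p' = p by apply: phi_inj; rewrite -vp.
move: (p'_on 0); rewrite vp' mevalD mevalZ p_on add0r eqxx mulr1n gG -vp => /eqP.
by rewrite mulf_eq0 (negbTE t_neq0) => /eqP.
Qed.
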